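(* Let $a$ and $k$ be positive integers. Given any finite subset $F \subset C[0,1]_{(a,k)}$ and any $\epsilon>0$, there is an integer $N>0$ with the following property: for any unital positive linear map $\phi: C[0,1]\to C[0,1]$ which preserves $C[0,1]_{(a,k)}$ (i.e. $\phi(C[0,1]_{(a,k)})\subseteq C[0,1]_{(a,k)}$), there are $N$ homomorphisms $\phi_1,\phi_2,\dots,\phi_N$ from $C[0,1]$ to $C[0,1]$ such that $\frac1N\sum_{i=1}^N \phi_i(f)\in C[0,1]_{(a,k)}$ for all $f\in C[0,1]_{(a,k)}$, and $$\Big\|\phi(f)-\frac1N\sum_{i=1}^N\phi_i(f)\Big\|<\epsilon\quad\text{for all } f\in F.$$
   Context: $C[0,1]$ is the C*-algebra of continuous functions on $[0,1]$ with the supremum norm. For positive integers $a,k$, $$C[0,1]_{(a,k)}=\{f\in C[0,1]\mid f(0)=\tfrac{a}{a+k}f(1)\}.$$ Homomorphism means $*$-homomorphism. A linear map is positive if it sends nonnegative functions to nonnegative functions, and unital if it sends the constant function $1$ to $1$. *)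

(* Defs.v *)
From HB Require Import structures.
From mathcomp Require Import all_boot all_order all_algebra.
From mathcomp Require Import complex.
From mathcomp Require Import all_classical all_reals all_analysis.

Set Implicit Arguments.
Unset Strict Implicit.
Unset Printing Implicit Defensive.

Import Order.TTheory GRing.Theory Num.Theory.
Import numFieldNormedType.Exports.

Local Open Scope classical_set_scope.
Local Open Scope ring_scope.

Section ContinuousAlgebra.
Context {T : topologicalType} {K : numClosedFieldType}.
Local Notation CT := (continuousType T K).

Definition cts : {pred T -> K} := mem [set f : T -> K | continuous f].

Definition cts_Sub (f : T -> K) (fP : f \in cts) : CT := mkcts (set_mem fP).

Lemma cts_rect (P : CT -> Type) :
  (forall f (fP : f \in cts), P (cts_Sub fP)) -> forall u : CT, P u.
Proof.
move=> Psub u.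
have uP : (u : T -> K) \in cts by apply/mem_set; exact: cts_fun.
by have -> : u = cts_Sub uP by apply/continuousEP.
Qed.

Lemma cts_SubK f (fP : f \in cts) : cts_Sub fP = f :> (T -> K).
Proof. by []. Qed.

HB.instance Definition _ := isSub.Build _ _ CT cts_rect cts_SubK.

Lemma cts_subring_closed : subring_closed cts.
Proof.
split=> [|f g|f g]; rewrite ?inE /=.
- by move=> x; exact: cvg_cst.
- by move=> cf cg x; apply: cvgB; [exact: cf|exact: cg].
- by move=> cf cg x; apply: cvgM; [exact: cf|exact: cg].
Qed.

Lemma cts_scaler_closed : scaler_closed cts.
Proof.
move=> c f; rewrite !inE /= => cf x.
by apply: cvgM; [exact: cvg_cst|exact: cf].
Qed.

HB.instance Definition _ := GRing.isSubringClosed.Build _ cts cts_subring_closed.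
HB.instance Definition _ := GRing.isScaleClosed.Build _ _ cts cts_scaler_closed.

HB.instance Definition _ := GRing.SubChoice_isSubComPzRing.Build _ _ CT (subringClosedP _).
HB.instance Definition _ := [SubZmodule_isSubLmodule of CT by <:].

Fact cts_conj_continuous (f : CT) : continuous (fun x => (f x)^* : K).
Proof.
move=> x; apply/cvgrPdist_lt => e e0.
have /cvgrPdist_lt/(_ e e0) := @cts_fun _ _ f x.
by apply: filterS => y; rewrite -rmorphB norm_conjC.
Qed.

Definition cts_conj (f : CT) : CT := mkcts (@cts_conj_continuous f).

End ContinuousAlgebra.

Section UnitInterval.
Context (R : realType).

(* Typing I01 and Cplx as structures, rather than as bare types, selects the
   subspace topology of R on [0, 1] and the norm topology on the complex
   numbers; R[i] alone has no topology in MathComp-Analysis. *)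
Definition I01 : topologicalType := set_type (`[0, 1]%classic : set R).

Definition Cplx : numClosedFieldType := R[i].

Fact I01_left_subproof : 0 \in (`[0, 1]%classic : set R).
Proof. by rewrite inE /= in_itv /= lexx ler01. Qed.

Fact I01_right_subproof : 1 \in (`[0, 1]%classic : set R).
Proof. by rewrite inE /= in_itv /= lexx ler01. Qed.

Definition I01_left : I01 := exist _ 0 I01_left_subproof.

Definition I01_right : I01 := exist _ 1 I01_right_subproof.

Definition C01 := continuousType I01 Cplx.

HB.instance Definition _ := GRing.ComPzRing.on C01.
HB.instance Definition _ := GRing.Lmodule.on C01.

Definition supnorm (f : C01) : R :=
  sup (range (fun x => ComplexField.Normc.normc (f x))).

(* In the order of Cplx, 0 <= z means that z is real and nonnegative. *)
Definition positive_map (phi : C01 -> C01) : Prop :=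
  forall f : C01, (forall x, 0 <= f x) -> forall x, 0 <= phi f x.

(* Not required to be unital: the zero map is a *-homomorphism. *)
Definition star_hom (psi : C01 -> C01) : Prop :=
  [/\ linear psi, {morph psi : f g / f * g} & {morph psi : f / cts_conj f}].

Definition C01_ak (a k : nat) : set C01 :=
  [set f : C01 | f I01_left = a%:R / (a + k)%N%:R * f I01_right].

Definition average (N : nat) (psi : 'I_N -> C01 -> C01) (f : C01) : C01 :=
  (N%:R : Cplx)^-1 *: \sum_(i < N) psi i f.

End UnitInterval.

(* Main.v *)
Require Import Defs.
From mathcomp Require Import all_boot all_order all_algebra.
From mathcomp Require Import complex ring lra.
From mathcomp Require Import all_classical all_reals all_analysis.

Set Implicit Arguments.
Unset Strict Implicit.
Unset Printing Implicit Defensive.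

Import Order.TTheory GRing.Theory Num.Theory.
Import numFieldNormedType.Exports.

Local Open Scope classical_set_scope.
Local Open Scope ring_scope.

(** Why the theorem is true.

    Let mu_x be the probability measure on [0,1] given by f |-> phi f x, and
    let lam = a / (a + k).  As phi maps the kernel of the functional
    f |-> f(0) - lam f(1) into itself, mu_0 - lam mu_1 is a multiple of
    delta_0 - lam delta_1; total masses show that the factor is 1.  Evaluated
    on f with f(0) = 0, f(1) = 1 and 0 <= f <= 1, this reads
    mu_0(f) + lam (1 - mu_1(f)) = 0, a sum of two nonnegative terms.  Hence
    mu_0(f) = 0 and mu_1(f) = 1, so that mu_0 and mu_1 are the point masses at
    0 and 1 ([preserves_endpoint_values] for such f).  This leaves room for
    approximating phi by compositions with continuous paths that fix 0 and 1,
    and an average of such compositions keeps the values of f at 0 and 1, hence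
    the boundary condition.

    The paths are quantile functions of mu_x, smoothed so as to be continuous
    in x.  Cut [0,N] into N unit steps and let r_i(u) in [0,1] be the part of
    the step [i, i+1] that lies below u ([ramp]).  The function s |-> r_j(N s)
    is a continuous version of the indicator of ]j/N, 1], so that
    p_j(x) := phi(r_j(N .))(x) is about the mass that mu_x gives to ]j/N, 1].
    The i-th path is x |-> (1/N) sum_j r_i(N p_j(x)): the quantile of mu_x at
    level 1 - i/N, up to the smoothing.  It fixes 0 and 1 since p_j(0) = 0 and
    p_j(1) = 1.

    One estimate serves twice.  A decreasing sequence c_0 >= ... >= c_(m-1) in
    [0,1] is the tail of a probability on the nodes l/m, and
    [stieltjes m c v] = v_0 + sum_j (v_(j+1) - v_j) c_j is the mean of v for
    it.  Its mean point is h = (1/m) sum_j c_j, and the distance of h to the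
    nodes is on average at most (1/m) sum_j 2 c_j (1 - c_j).  So if
    |f s - f t| <= eta + C |s - t|, a bound that holds with C large for any
    given f and eta, then f(h) differs from the mean of f at the nodes by at
    most eta + (C/m) sum_j 2 c_j (1 - c_j)  ([C01_stieltjes_defect]).
    - With c_j = r_j(N s), at most one c_j differs from 0 and 1, so f is within
      eta + 2C/N of its interpolant at the nodes ([interpolant_error]).
    - With c_j = r_i(N p_j(x)), the point h is the i-th path at x.  Averaging
      over i gives back sum_i r_i(N p_j) = N p_j, hence exactly phi of the
      interpolant; the errors average to at most eta + 2C/N, since for each j
      at most one i is such that c_j differs from 0 and 1
      ([path_average_error]).
    As phi is bounded ([positive_map_norm]), the total error is at most
    3 (eta + 2C/N), and N depends on F and eps only, through eta and C. *)

(** * Unit steps of the line *)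

Section Ramp.
Context {R : realFieldType}.
Implicit Types (u v : R) (i n : nat).

Definition ramp u i : R := Num.min 1 (Num.max 0 (u - i%:R)).

Lemma ramp_itv u i : 0 <= ramp u i <= 1.
Proof. by rewrite le_min le_max ge_min !lexx ler01. Qed.

Lemma ler_ramp u v i : u <= v -> ramp u i <= ramp v i.
Proof. by move=> uv; rewrite /ramp le_min2 ?le_max2 ?lerB. Qed.

Lemma ramp_decr u i : ramp u i.+1 <= ramp u i.
Proof. by rewrite /ramp le_min2 ?le_max2 ?lerB ?ler_nat. Qed.

Lemma ramp0 u i : u <= i%:R -> ramp u i = 0.
Proof.
by move=> ui; rewrite /ramp (max_idPl _) ?subr_le0// (min_idPr _)// ler01.
Qed.

Lemma ramp1 u i : i.+1%:R <= u -> ramp u i = 1.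
Proof.
rewrite -natr1 => ui; rewrite /ramp (max_idPr _) ?(min_idPl _)//; lra.
Qed.

Lemma ramp_mid u i : i%:R <= u <= i.+1%:R -> ramp u i = u - i%:R.
Proof.
rewrite -natr1 => ui; rewrite /ramp (max_idPr _) ?(min_idPr _)//; lra.
Qed.

(** The steps [i, i+1] with i < n cut [0, u] into pieces of length
    [ramp u i]. *)
Lemma sum_ramp u n : 0 <= u <= n%:R -> \sum_(i < n) ramp u i = u.
Proof.
elim: n => [|n IHn] /andP[u0 un]; first by rewrite big_ord0; lra.
rewrite big_ord_recr /=; have [nu|nu] := leP n%:R u; last first.
  by rewrite IHn ?u0 ?ltW// ramp0 ?addr0// ltW.
rewrite (eq_bigr (fun=> 1)) => [|i _]; last first.
  by rewrite ramp1// (le_trans _ nu)// ler_nat.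
by rewrite sumr_const card_ord ramp_mid ?nu//; lra.
Qed.

(** At most one [ramp u i] is strictly between 0 and 1: that of the step
    containing u. *)
Lemma sum_ramp_bump u n : \sum_(i < n) ramp u i * (1 - ramp u i) <= 1.
Proof.
elim: n => [|n IHn]; first by rewrite big_ord0.
rewrite big_ord_recr /=; have [nu|nu] := leP n%:R u; last first.
  by rewrite (ramp0 (ltW nu)) mul0r addr0.
rewrite big1 => [|i _]; last first.
  by rewrite ramp1 ?subrr ?mulr0// (le_trans _ nu)// ler_nat.
by have := ramp_itv u n; nra.
Qed.

End Ramp.

(** * Means on equally spaced nodes *)

Section Staircase.
Context {K : numDomainType}.
Implicit Types (c v : nat -> K) (m : nat).

(** The integral of v over the nodes 0, ..., m for the probability that gives
    mass [c j] to the nodes above j, written by parts so that it is visibly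
    linear in the tail [c]. *)
Definition stieltjes m c v : K := v 0%N + \sum_(j < m) (v j.+1 - v j) * c j.

(** Summation by parts: the weight of the node l is c_(l-1) - c_l, with
    c_(-1) = 1 and c_m = 0. *)
Lemma stieltjes_weights m c :
  (forall j, 0 <= c j <= 1) -> (forall j, c j.+1 <= c j) ->
  exists2 w : nat -> K, forall l, 0 <= w l &
    forall v, stieltjes m c v = \sum_(l < m.+1) w l * v l.
Proof.
move=> c01 c_decr.
pose d l := if l is j.+1 then if (j < m)%N then c j else 0 else 1.
exists (fun l => d l - d l.+1) => [[|l]|v]; rewrite ?subr_ge0 /=.
- by case: ifP => // _; have /andP[] := c01 0%N.
- case: ifP => [lm|_]; first by rewrite ltnW.
  by case: ifP => // _; have /andP[] := c01 l.
have abel n : \sum_(l < n.+1) (d l - d l.+1) * v l =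
    v 0%N - d n.+1 * v n + \sum_(j < n) (v j.+1 - v j) * d j.+1.
  elim: n => [|n IHn]; first by rewrite big_ord_recr !big_ord0 /= ; ring.
  by rewrite big_ord_recr IHn [in RHS]big_ord_recr /=; ring.
rewrite abel /= ltnn mul0r subr0; congr (_ + _).
by apply: eq_bigr => j _; rewrite ltn_ord.
Qed.

Lemma stieltjes_cst m c a : stieltjes m c (fun=> a) = a.
Proof. by rewrite /stieltjes big1 ?addr0// => j _; rewrite subrr mul0r. Qed.

(** The nodes above j have total mass [c j]. *)
Lemma stieltjes_step m c (j : 'I_m) (a b : K) :
  stieltjes m c (fun l => if (j < l)%N then b else a) = a + (b - a) * c j.
Proof.
rewrite /stieltjes ltn0 (bigD1 j)//= ltnSn ltnn big1 ?addr0// => i.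
rewrite ltnS => ij; suff -> : (j <= i)%N = (j < i)%N by rewrite subrr mul0r.
by rewrite leq_eqVlt eq_sym (negPf (ij : nat_of_ord i != j)).
Qed.

(** The sum [`|c j - (j < l)|] summed over j is m times the bound for the
    distance of the mean point to the node l.  Averaging it over l, the term j
    takes the value 1 - c_j with probability c_j and c_j with probability
    1 - c_j, which gives 2 c_j (1 - c_j). *)
Lemma stieltjes_defect m c v (z : K) (eta C : K) :
  (forall j, 0 <= c j <= 1) -> (forall j, c j.+1 <= c j) ->
  (forall l, (l <= m)%N ->
    `|z - v l| <= eta + C * \sum_(j < m) `|c j - (j < l)%N%:R|) ->
  `|z - stieltjes m c v| <=
    eta + C * \sum_(j < m) (c j * (1 - c j)) *+ 2.
Proof.
move=> c01 c_decr zv; have [w w0 wE] := stieltjes_weights m c01 c_decr.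
have w1 a : \sum_(l < m.+1) w l * a = a.
  by rewrite -(wE (fun=> a)) stieltjes_cst.
rewrite wE -{1}(w1 z) -sumrB (le_trans (ler_norm_sum _ _ _))//.
apply: le_trans (_ : \sum_(l < m.+1) w l *
    (eta + C * \sum_(j < m) `|c j - (j < l)%N%:R|) <= _).
  apply: ler_sum => l _; rewrite -mulrBr normrM ger0_norm//.
  by rewrite ler_wpM2l// zv// -ltnS.
under eq_bigr do rewrite mulrDr.
rewrite big_split /= w1 lerD2l.
under eq_bigr do rewrite mulrCA mulr_sumr.
rewrite -mulr_sumr exchange_big /=; under eq_bigr => j _.
  have /andP[c0 c1] := c01 j.
  rewrite (eq_bigr (fun l : 'I_m.+1 =>
      w l * (if (j < l)%N then 1 - c j else c j))) => [|l _]; last first.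
    congr (_ * _); case: ifP => _; last by rewrite subr0 ger0_norm.
    by rewrite distrC ger0_norm// subr_ge0.
  rewrite -(wE (fun l => if (j < l)%N then 1 - c j else c j)) stieltjes_step.
  have -> : c j + (1 - c j - c j) * c j = (c j * (1 - c j)) *+ 2 by ring.
  over.
by [].
Qed.

End Staircase.

(** * Moduli of continuity *)

Section Modulus.
Context {R : realType}.

(** Near a zero of D, the bound holds by continuity of G; near any other point,
    D is bounded away from 0 and a large C does it.  Compactness gives one C
    for all points. *)
Lemma compact_affine_bound {X : topologicalType} (K : set X) (G D : X -> R)
    (eta : R) :
  compact K -> continuous G -> continuous D -> (forall x, 0 <= D x) ->
  (forall x, D x = 0 -> G x < eta) ->
  exists2 C : R, 0 <= C & forall x, K x -> G x <= eta + C * D x.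
Proof.
move=> /compact_near_coveringP cK Gc Dc D0 DG.
pose P (C : R) x := 0 <= C /\ G x <= eta + C * D x.
suff : \forall C \near +oo, K `<=` P C.
  move=> near_inf; near (pinfty_nbhs R) => C; exists C.
    by near: C; exact: nbhs_pinfty_ge.
  by move=> x Kx; have [] : P C x by apply: (near near_inf C).
apply: cK => x Kx; have [Dx0|Dx0] := eqVneq (D x) 0.
  exists ([set y | G y < eta], [set C | 0 <= C]).
    split; last exact: nbhs_pinfty_ge.
    exact: (cvgr_lt _ (Gc x) _ (DG x Dx0)).
  move=> [y C] [/= Gy C0]; split=> //.
  by rewrite (le_trans (ltW Gy))// lerDl mulr_ge0.
have {}Dx0 : 0 < D x by rewrite lt_def Dx0 D0.
exists ([set y | G y < G x + 1 /\ D x / 2 < D y],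
        [set C | 0 <= C /\ `|G x + 1 - eta| / (D x / 2) <= C]).
  split; near=> z; split.
  - by near: z; apply: (cvgr_lt _ (Gc x)); rewrite ltrDl.
  - near: z; apply: (cvgr_gt _ (Dc x)).
    by rewrite ltr_pdivrMr// ltr_pMr// ltr1n.
  - by near: z; exact: nbhs_pinfty_ge.
  - by near: z; apply: nbhs_pinfty_ge; rewrite num_real.
move=> [y C] [/= [Gy Dy] [C0 CB]]; split => //.
rewrite -lerBlDl; apply: le_trans (_ : C * (D x / 2) <= _); last first.
  by rewrite ler_wpM2l// ltW.
rewrite -ler_pdivrMr ?divr_gt0//; apply: le_trans CB.
rewrite ler_pM2r ?invr_gt0 ?divr_gt0//; apply: le_trans (ler_norm _).
by rewrite lerB// ltW.
Unshelve. all: by end_near. Qed.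

End Modulus.

Section Interval.
Context {R : realType}.
Local Notation I := (I01 R).
Local Notation K := (Cplx R).

Lemma clamp_itv (u : R) : ramp u 0 \in (`[0, 1]%classic : set R).
Proof. by rewrite inE /= in_itv /= ramp_itv. Qed.

(** A total retraction of the line onto the interval, so that points of the
    interval can be given by real formulas without carrying bounds. *)
Definition clamp (u : R) : I := exist _ (ramp u 0) (clamp_itv u).

Definition abscissa (s : I) : R := sval s.

Lemma abscissa_itv (s : I) : 0 <= abscissa s <= 1.
Proof. by case: s => u /= /set_mem /=; rewrite in_itv. Qed.

Lemma abscissa_clamp u : 0 <= u <= 1 -> abscissa (clamp u) = u.
Proof. by move=> u01; rewrite /= ramp_mid ?subr0. Qed.

Lemma clampK : cancel abscissa clamp.
Proof.
move=> s; apply: val_inj.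
by rewrite /= -/(abscissa s) ramp_mid ?subr0 ?abscissa_itv.
Qed.

Lemma abscissa_continuous : continuous abscissa.
Proof. exact: initial_continuous. Qed.

Lemma ramp_continuous i : continuous (fun u : R => ramp u i).
Proof.
move=> u.
have := @continuous_min R R (fun=> 1) (fun u => Num.max 0 (u - i%:R)) u.
have := @continuous_max R R (fun=> 0) (fun u => u - i%:R) u.
move=> cmax cmin; apply: cmin; first exact: cvg_cst.
apply: cmax; first exact: cvg_cst.
by apply: cvgB; [exact: cvg_id|exact: cvg_cst].
Qed.

Lemma clamp_continuous : continuous clamp.
Proof. apply: continuous_comp_initial; exact: ramp_continuous. Qed.

Lemma norm_RtoC (u : R) : `|(u%:C)%C : K| = (`|u|%:C)%C.
Proof. by rewrite normc_def /= expr0n addr0 sqrtr_sqr. Qed.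

Lemma RtoC_continuous : continuous (fun u : R => (u%:C)%C : K).
Proof.
move=> u; apply/cvgrPdist_lt => e; rewrite ltcE /= => /andP[/eqP e0 Re0].
near=> v; rewrite -rmorphB norm_RtoC.
rewrite ltcE /= e0 eqxx /=; near: v.
exact: (@cvgr_dist_lt _ _ _ _ _ id).
Unshelve. all: by end_near. Qed.

Lemma Re_continuous : continuous (fun z : K => complex.Re z).
Proof.
move=> z; apply/(@cvgrPdist_lt _ _ _ _ (nbhs_filter z)) => e e0.
have e0C : 0 < (e%:C)%C :> K by rewrite ltcR.
have /(@cvgrPdist_lt _ _ _ _ (nbhs_filter z))/(_ _ e0C) := @cvg_id _ (nbhs z).
apply: filterS => w zw; rewrite -ltcR; apply: le_lt_trans zw.
have -> : complex.Re z - complex.Re w = complex.Re (z - w).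
  by case: z w => ? ? [].
exact: normc_ge_Re.
Qed.

(** A substitute for a Lipschitz bound: eta absorbs the lack of regularity of f
    at small distances.  It is [compact_affine_bound] on the unit square. *)
Lemma C01_modulus (f : C01 R) (eta : R) : 0 < eta ->
  exists2 C : R, 0 <= C &
    forall s t, `|f s - f t| <= ((eta + C * `|abscissa s - abscissa t|)%:C)%C.
Proof.
move=> eta0.
pose G (p : R * R) := complex.Re `|f (clamp p.1) - f (clamp p.2)|.
pose D (p : R * R) := `|p.1 - p.2|.
have fc : continuous (fun u : R => f (clamp u)).
  by move=> u; apply: continuous_comp; [exact: clamp_continuous|exact: cts_fun].
have cK : compact (`[0, 1]%classic `*` `[0, 1]%classic : set (R * R)).
  by apply: compact_setX; exact: segment_compact.
have Hc : continuous (fun p : R * R => `|f (clamp p.1) - f (clamp p.2)| : K).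
  move=> p; apply: cvg_norm; apply: cvgB.
    by apply: (continuous_comp _ (fc _)); exact: cvg_fst.
  by apply: (continuous_comp _ (fc _)); exact: cvg_snd.
have Gc : continuous G.
  by move=> p; apply: (continuous_comp (Hc p) (@Re_continuous _)).
have Dc : continuous D.
  by move=> p; apply: cvg_norm; apply: cvgB; [exact: cvg_fst|exact: cvg_snd].
have [p|p /eqP|C C0 GD] := compact_affine_bound (eta := eta) cK Gc Dc.
- exact: normr_ge0.
- by rewrite normr_eq0 subr_eq0 => /eqP pE; rewrite /G pE subrr normr0.
exists C => // s t.
have := GD (abscissa s, abscissa t).
rewrite /G /D /= !clampK => /(_ _)/wrap[].
  by split => /=; rewrite in_itv /= abscissa_itv.
by move=> GDst; rewrite -[leLHS]RRe_real ?lecR// normr_real.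
Qed.

End Interval.

(** * Unital positive maps *)

Section Positive.
Context {R : realType}.
Local Notation I := (I01 R).
Local Notation K := (Cplx R).
Implicit Types (f g : C01 R) (x s : I).

Lemma C01_addE f g x : (f + g) x = f x + g x. Proof. by []. Qed.
Lemma C01_oppE f x : (- f) x = - f x. Proof. by []. Qed.
Lemma C01_scaleE (a : K) f x : (a *: f) x = a * f x. Proof. by []. Qed.
Lemma C01_oneE x : (1 : C01 R) x = 1. Proof. by []. Qed.
Lemma C01_sumE n (F : 'I_n -> C01 R) x :
  (\sum_(i < n) F i) x = \sum_(i < n) F i x.
Proof. by apply: (big_morph (fun f : C01 R => f x)). Qed.

Definition C01E := (C01_addE, C01_oppE, C01_scaleE, C01_oneE).

Section PositiveMap.
Variable phi : {linear C01 R -> C01 R}.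
Hypotheses (phi_pos : positive_map phi) (phi1 : phi 1 = 1).

Lemma positive_map_le f g x : (forall s, f s <= g s) -> phi f x <= phi g x.
Proof.
move=> fg; have := phi_pos (f := g - f).
rewrite linearB => /(_ _ x); rewrite !C01E subr_ge0; apply=> s.
by rewrite !C01E subr_ge0.
Qed.

Lemma positive_map_cst (a : K) x : phi (a *: (1 : C01 R)) x = a.
Proof. by rewrite linearZ phi1 !C01E mulr1. Qed.

Lemma positive_map_norm_real f (e : K) x :
  (forall s, f s \is Num.real) -> (forall s, `|f s| <= e) -> `|phi f x| <= e.
Proof.
move=> fR fe; have fE s : - e <= f s <= e by rewrite -real_ler_norml.
have e_real : e \is Num.real.
  by rewrite ger0_real// (le_trans (normr_ge0 _) (fe x)).
have le1 : phi f x <= e.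
  rewrite -[leRHS](positive_map_cst _ x); apply: positive_map_le => s.
  by rewrite !C01E mulr1; have /andP[] := fE s.
have le2 : - e <= phi f x.
  rewrite -[leLHS](positive_map_cst _ x); apply: positive_map_le => s.
  by rewrite !C01E mulr1; have /andP[] := fE s.
rewrite real_ler_norml ?le1 ?le2//.
by rewrite (ler_real le1).
Qed.

(** The factor 2 comes from treating real and imaginary parts separately; the
    sharp constant is 1. *)
Lemma positive_map_norm f (e : K) x :
  (forall s, `|f s| <= e) -> `|phi f x| <= e *+ 2.
Proof.
move=> fe.
pose g : C01 R := 2^-1 *: (f + cts_conj f).
pose h : C01 R := ('i / 2) *: (cts_conj f - f).
have gE s : g s = 'Re (f s) by rewrite ReE mulrC.
have hE s : h s = 'Im (f s) by rewrite ImE; rewrite !C01E /=; ring.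
clearbody g h; have -> : f = g + 'i *: h.
  apply/continuousEP => s.
  by rewrite C01_addE [X in _ + X]C01_scaleE gE hE -Crect.
rewrite linearD linearZ C01_addE C01_scaleE.
apply: le_trans (ler_normD _ _) _.
rewrite normrM normCi mul1r mulr2n lerD//; apply: positive_map_norm_real => s.
- by rewrite gE Creal_Re.
- by rewrite gE (le_trans (leif_normC_Re_Creal _).1).
- by rewrite hE Creal_Im.
- rewrite hE -['Im _]opprK -ReMil; apply: le_trans (fe s).
  by rewrite normrN (le_trans (leif_normC_Re_Creal _).1)// normrM normCi mul1r.
Qed.

(** Subtracting from f the right constant t gives a function g of the
    subspace, and g(0) = lam g(1) is inherited by phi g; this yields
    phi f 0 + lam (1 - phi f 1) = 0 where both terms are nonnegative. *)
Lemma preserves_endpoint_values a k f : (0 < a)%N -> (0 < k)%N ->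
  (forall g, C01_ak a k g -> C01_ak a k (phi g)) ->
  f (I01_left R) = 0 -> f (I01_right R) = 1 ->
  (forall s, 0 <= f s <= 1) ->
  phi f (I01_left R) = 0 /\ phi f (I01_right R) = 1.
Proof.
move=> a0 k0 phi_ak f0 f1 f01.
pose lam : K := a%:R / (a + k)%N%:R.
have ak0 : (a + k)%N%:R != 0 :> K by rewrite pnatr_eq0 -lt0n addn_gt0 a0.
have lam0 : 0 < lam by rewrite divr_gt0 ?ltr0n ?addn_gt0 ?a0.
have lam1 : 1 - lam != 0.
  rewrite subr_eq0 eq_sym -(inj_eq (mulIf ak0)) mulfVK// mul1r eqr_nat.
  by rewrite neq_ltn -[X in (X < _)%N]addn0 ltn_add2l k0.
(* The constant for which f - t satisfies the boundary condition, given
   f(0) = 0 and f(1) = 1. *)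
pose t := - lam / (1 - lam).
pose g : C01 R := f - t *: (1 : C01 R).
have gE s : g s = f s - t by rewrite C01_addE C01_oppE C01_scaleE mulr1.
have phi_gE s : phi g s = phi f s - t.
  by rewrite linearB C01_addE C01_oppE positive_map_cst.
have eq1 : phi f (I01_left R) - t = lam * (phi f (I01_right R) - t).
  rewrite -!phi_gE; apply: phi_ak; rewrite /C01_ak /= !gE f0 f1 -/lam /t.
  by field.
have p0 : 0 <= phi f (I01_left R).
  by apply: phi_pos => s; have /andP[] := f01 s.
have p1 : phi f (I01_right R) <= 1.
  rewrite -[leRHS](positive_map_cst 1 (I01_right R)).
  by apply: positive_map_le => s; rewrite !C01E mulr1; have /andP[] := f01 s.
have : phi f (I01_left R) + lam * (1 - phi f (I01_right R)) = 0.
  have -> : phi f (I01_left R) = lam * (phi f (I01_right R) - t) + t.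
    by rewrite -eq1 subrK.
  by rewrite /t; field.
move/eqP; rewrite paddr_eq0//; last by rewrite mulr_ge0 ?subr_ge0// ltW.
rewrite mulf_eq0 (gt_eqF lam0) /= subr_eq0 => /andP[/eqP-> /eqP<-].
by [].
Qed.

End PositiveMap.
End Positive.

(** * Quantile paths *)

Section QuantilePaths.
Context {R : realType}.
Local Notation I := (I01 R).
Local Notation K := (Cplx R).
Implicit Types (f g : C01 R) (x s : I).

Lemma ramp_function_continuous N j :
  continuous (fun s : I => ((ramp (N%:R * abscissa s) j)%:C)%C : K).
Proof.
move=> s.
have Nc := continuous_comp (@abscissa_continuous R s)
  (@mulrl_continuous R N%:R _).
have rc := continuous_comp Nc (@ramp_continuous R j _).
exact: (continuous_comp rc (@RtoC_continuous R _)).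
Qed.

Definition ramp_function N j : C01 R := mkcts (@ramp_function_continuous N j).

Definition node (N l : nat) : I := clamp (l%:R / N%:R).

(** The piecewise linear interpolation of f at the nodes, expanded on ramps
    rather than on hat functions: ramps have values that decrease with j, and so
    do their images under a positive map. *)
Definition interpolant N f : C01 R := f (node N 0) *: (1 : C01 R) +
  \sum_(j < N) (f (node N j.+1) - f (node N j)) *: ramp_function N j.

Lemma abscissa_node N l : (0 < N)%N -> (l <= N)%N ->
  abscissa (node N l) = l%:R / N%:R.
Proof.
move=> N0 lN; rewrite abscissa_clamp// divr_ge0//= ler_pdivrMr ?ltr0n//.
by rewrite mul1r ler_nat.
Qed.

Lemma sum_lt_ord N l : (l <= N)%N -> \sum_(j < N) ((j < l)%N%:R : R) = l%:R.
Proof.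
move=> lN; rewrite -natr_sum; congr _%:R.
rewrite (eq_bigr (fun j : 'I_N => if (j < l)%N then 1 else 0)%N) => [|j _].
  2: by case: ifP.
by rewrite -big_mkcond /= (big_ord_narrow lN) sum1_card card_ord.
Qed.

(** The form of [stieltjes_defect] for a continuous function: the mean point h
    and the node l/N are (1/N) sum_j c_j and (1/N) sum_j (j < l), so their
    distance is at most (1/N) sum_j |c_j - (j < l)|. *)
Lemma C01_stieltjes_defect f (eta C : R) N (c : nat -> R) :
  (0 < N)%N -> 0 <= C ->
  (forall s t, `|f s - f t| <= ((eta + C * `|abscissa s - abscissa t|)%:C)%C) ->
  (forall j, 0 <= c j <= 1) -> (forall j, c j.+1 <= c j) ->
  `|f (clamp ((\sum_(j < N) c j) / N%:R)) -
    stieltjes N (fun j => ((c j)%:C)%C) (fun l => f (node N l))| <=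
  ((eta + C / N%:R * \sum_(j < N) (c j * (1 - c j)) *+ 2)%:C)%C.
Proof.
move=> N0 C0 f_mod c01 c_decr.
have N0R : 0 < N%:R :> R by rewrite ltr0n.
set h := _ / N%:R.
have h01 : 0 <= h <= 1.
  rewrite divr_ge0 ?sumr_ge0//= => [|j _]; last by have /andP[] := c01 j.
  rewrite ler_pdivrMr// mul1r -[X in _ <= X%:R]card_ord -sumr_const.
  by apply: ler_sum => j _; have /andP[] := c01 j.
have -> : ((eta + C / N%:R * \sum_(j < N) (c j * (1 - c j)) *+ 2)%:C)%C =
    (eta%:C)%C + ((C / N%:R)%:C)%C *
      \sum_(j < N) (((c j)%:C)%C * (1 - ((c j)%:C)%C)) *+ 2 :> K.
  rewrite rmorphD rmorphM; congr (_ + _ * _); rewrite rmorph_sum.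
  by apply: eq_bigr => j _; rewrite rmorphMn rmorphM rmorphB rmorph1.
apply: stieltjes_defect => [j|j|l lN]; rewrite ?lecR ?ler0c//.
apply: le_trans (f_mod _ _) _.
under eq_bigr => j _.
  have -> : ((j < l)%N%:R : K) = ((j < l)%N%:R%:C)%C by rewrite rmorph_nat.
  rewrite -rmorphB norm_RtoC.
  over.
rewrite -rmorph_sum -rmorphM -rmorphD lecR lerD2l.
rewrite abscissa_clamp// abscissa_node//.
rewrite -mulrA ler_wpM2l// /h -mulrBl normrM mulrC gtr0_norm ?invr_gt0//.
rewrite ler_pM2l ?invr_gt0// -(sum_lt_ord lN) -sumrB.
exact: ler_norm_sum.
Qed.

Lemma interpolantE N f s : interpolant N f s =
  stieltjes N (fun j => ((ramp (N%:R * abscissa s) j)%:C)%C)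
    (fun l => f (node N l)).
Proof.
by rewrite C01_addE C01_scaleE mulr1 C01_sumE.
Qed.

(** The ramps at s are the tail of a probability on the two nodes next to s,
    with mean point s. *)
Lemma interpolant_error f (eta C : R) N s : (0 < N)%N -> 0 <= C ->
  (forall s t, `|f s - f t| <= ((eta + C * `|abscissa s - abscissa t|)%:C)%C) ->
  `|f s - interpolant N f s| <= ((eta + C / N%:R *+ 2)%:C)%C.
Proof.
move=> N0 C0 f_mod; have N0R : 0 < N%:R :> R by rewrite ltr0n.
pose c j := ramp (N%:R * abscissa s) j.
have := C01_stieltjes_defect N0 C0 f_mod (c := c) (fun=> ramp_itv _ _)
  (ramp_decr _).
rewrite sum_ramp; last first.
  have /andP[s0 s1] := abscissa_itv s.
  by rewrite mulr_ge0 ?ler0n// -[leRHS]mulr1 ler_wpM2l.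
rewrite mulrAC mulfV ?gt_eqF// mul1r clampK -interpolantE => /le_trans; apply.
rewrite lecR lerD2l sumrMnl mulrnAr ler_wMn2r//.
by rewrite ler_piMr ?divr_ge0// sum_ramp_bump.
Qed.

Section Paths.
Variable phi : {linear C01 R -> C01 R}.
Hypotheses (phi_pos : positive_map phi) (phi1 : phi 1 = 1).

(** The values of phi on ramps are real, so that their real parts lose nothing;
    reading them in R allows to compose them with ramps. *)
Definition ramp_image N j x : R := complex.Re (phi (ramp_function N j) x).

Lemma ramp_imageE N j x :
  phi (ramp_function N j) x = ((ramp_image N j x)%:C)%C.
Proof.
rewrite RRe_real// ger0_real//; apply: phi_pos => s.
by rewrite ler0c; have /andP[] := ramp_itv (N%:R * abscissa s) j.
Qed.

Lemma ramp_image_itv N j x : 0 <= ramp_image N j x <= 1.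
Proof.
rewrite -ler0c -[_ <= 1]lecR -!ramp_imageE rmorph1.
rewrite phi_pos /= => [|s]; last first.
  by rewrite ler0c; have /andP[] := ramp_itv (N%:R * abscissa s) j.
rewrite -[leRHS](positive_map_cst phi1 1 x); apply: positive_map_le => // s.
rewrite C01_scaleE mulr1 lecR.
by have /andP[] := ramp_itv (N%:R * abscissa s) j.
Qed.

Lemma ramp_image_decr N j x : ramp_image N j.+1 x <= ramp_image N j x.
Proof.
rewrite -lecR -!ramp_imageE; apply: positive_map_le => // s.
by rewrite lecR ramp_decr.
Qed.

Lemma ramp_image_continuous N j : continuous (ramp_image N j).
Proof.
by move=> x; apply: (continuous_comp (@cts_fun _ _ _ x) (@Re_continuous R _)).
Qed.

(** The length of {s | p_s > i/N}, smoothed, where p_s is the mass of mu_x above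
    s.  It decreases with i. *)
Definition quantile N i x : R :=
  (\sum_(j < N) ramp (N%:R * ramp_image N j x) i) / N%:R.

Definition quantile_path N i x : I := clamp (quantile N i x).

Lemma quantile_path_continuous N i : continuous (quantile_path N i).
Proof.
move=> x.
have sc : continuous (fun y => \sum_(j < N) ramp (N%:R * ramp_image N j y) i).
  apply: continuous_big => [|j _ y]; first exact: add_continuous.
  have rc := continuous_comp (@ramp_image_continuous N j y)
    (@mulrl_continuous R N%:R _).
  exact: (continuous_comp rc (@ramp_continuous R i _)).
have hc := continuous_comp (sc x) (@mulrr_continuous R N%:R^-1 _).
exact: (continuous_comp hc (@clamp_continuous R _)).
Qed.

Lemma comp_path_continuous N i f :
  continuous (fun x => f (quantile_path N i x)).
Proof.
move=> x.
exact: (continuous_comp (@quantile_path_continuous N i x) (@cts_fun _ _ f _)).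
Qed.

Definition path_hom N i f : C01 R := mkcts (@comp_path_continuous N i f).

Lemma path_hom_star N i : star_hom (path_hom N i).
Proof.
split=> [a f g|f g|f]; exact/continuousEP.
Qed.

(** The reason for the choice of the paths: over i, the ramps of N p_j sum up to
    N p_j, so nothing is lost on average. *)
Lemma sum_path_stieltjes N (v : nat -> K) x :
  \sum_(i < N) stieltjes N
     (fun j => ((ramp (N%:R * ramp_image N j x) i)%:C)%C) v =
  N%:R * stieltjes N (fun j => ((ramp_image N j x)%:C)%C) v.
Proof.
rewrite /stieltjes big_split /= sumr_const card_ord mulrDr mulr_natl.
congr (_ + _); rewrite exchange_big mulr_sumr /=; apply: eq_bigr => j _.
rewrite -mulr_sumr mulrCA; congr (_ * _); rewrite -rmorph_sum sum_ramp.
  by rewrite rmorphM rmorph_nat.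
have /andP[p0 p1] := ramp_image_itv N j x.
by rewrite mulr_ge0 ?ler0n// -[leRHS]mulr1 ler_wpM2l ?ler0n.
Qed.

Lemma phi_interpolantE N f x : phi (interpolant N f) x =
  stieltjes N (fun j => ((ramp_image N j x)%:C)%C) (fun l => f (node N l)).
Proof.
rewrite /interpolant linearD linear_sum C01_addE positive_map_cst// C01_sumE.
congr (_ + _); apply: eq_bigr => j _.
by rewrite linearZ C01_scaleE ramp_imageE.
Qed.

(** Each path contributes a defect sum_j 2 c_ij (1 - c_ij); these are not small
    for each i, but for each j the sum over i is at most 2. *)
Lemma path_average_error f (eta C : R) N x : (0 < N)%N -> 0 <= C ->
  (forall s t, `|f s - f t| <= ((eta + C * `|abscissa s - abscissa t|)%:C)%C) ->
  `|phi (interpolant N f) x - average (fun i : 'I_N => path_hom N i) f x| <=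
    ((eta + C / N%:R *+ 2)%:C)%C.
Proof.
move=> N0 C0 f_mod; have N0R : 0 < N%:R :> R by rewrite ltr0n.
have N0K : 0 < N%:R :> K by rewrite ltr0n.
rewrite phi_interpolantE /average C01_scaleE C01_sumE.
set L := stieltjes _ _ _.
have -> : L = N%:R^-1 * (N%:R * L) by rewrite mulKf// gt_eqF.
rewrite -sum_path_stieltjes -mulrBr -sumrB normrM gtr0_norm ?invr_gt0//.
rewrite ler_pdivrMl//; apply: le_trans (ler_norm_sum _ _ _) _.
pose c i j := ramp (N%:R * ramp_image N j x) i.
apply: le_trans (_ : \sum_(i < N) ((eta + C / N%:R *
    \sum_(j < N) (c i j * (1 - c i j)) *+ 2)%:C)%C <= _).
  apply: ler_sum => i _; rewrite distrC.
  apply: (C01_stieltjes_defect N0 C0 f_mod (c := c i)) => j.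
    exact: ramp_itv.
  by rewrite ler_ramp// ler_wpM2l ?ler0n// ramp_image_decr.
have -> : N%:R = ((N%:R)%:C)%C :> K by rewrite rmorph_nat.
rewrite -rmorph_sum -rmorphM lecR.
rewrite big_split /= sumr_const card_ord mulrDr mulr_natl lerD2l.
rewrite -mulr_sumr mulrnAr mulrCA mulfV ?gt_eqF// mulr1.
under eq_bigr do rewrite sumrMnl.
rewrite sumrMnl mulrnAr ler_wMn2r// exchange_big /=.
rewrite -mulrA ler_piMr// ler_pdivrMl// mulr1.
rewrite -[X in _ <= X%:R]card_ord -sumr_const; apply: ler_sum => j _.
exact: sum_ramp_bump.
Qed.

Lemma quantile_path_left N (i : 'I_N) :
  (forall j, (j < N)%N -> ramp_image N j (I01_left R) = 0) ->
  quantile_path N i (I01_left R) = I01_left R.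
Proof.
move=> r0; apply: val_inj; rewrite /= /quantile big1 => [|j _].
  by rewrite mul0r ramp0.
by rewrite r0// mulr0 ramp0.
Qed.

Lemma quantile_path_right N (i : 'I_N) :
  (forall j, (j < N)%N -> ramp_image N j (I01_right R) = 1) ->
  quantile_path N i (I01_right R) = I01_right R.
Proof.
move=> r1; have N0 : (0 < N)%N by case: N i {r1} => // -[].
apply: val_inj; rewrite /= /quantile (eq_bigr (fun=> 1)) => [|j _].
  by rewrite sumr_const card_ord mulfV ?ramp1// pnatr_eq0 -lt0n.
by rewrite r1// mulr1 ramp1// ler_nat.
Qed.

Lemma average_path_hom_fixed N f x : (0 < N)%N ->
  (forall i : 'I_N, quantile_path N i x = x) ->
  average (fun i : 'I_N => path_hom N i) f x = f x.
Proof.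
move=> N0 xx; rewrite /average C01_scaleE C01_sumE.
rewrite (eq_bigr (fun=> f x)) => [|i _]; last by rewrite /= /mkcts xx.
by rewrite sumr_const card_ord -[f x *+ N]mulr_natl mulKf// pnatr_eq0 -lt0n.
Qed.

(** Replacing f by its interpolant under phi costs twice the interpolation
    error, averaging over paths costs once the same bound. *)
Lemma path_average_approx f (eta C : R) N x : (0 < N)%N -> 0 <= C ->
  (forall s t, `|f s - f t| <= ((eta + C * `|abscissa s - abscissa t|)%:C)%C) ->
  `|phi f x - average (fun i : 'I_N => path_hom N i) f x| <=
    (((eta + C / N%:R *+ 2) *+ 3)%:C)%C.
Proof.
move=> N0 C0 f_mod; pose g : C01 R := interpolant N f.
have phi_fg : phi f x - phi g x = phi (f - g) x by rewrite linearB.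
rewrite -(subrKA (phi g x)) (le_trans (ler_normD _ _))//.
rewrite mulrS addrC rmorphD lerD ?path_average_error// phi_fg rmorphMn.
apply: positive_map_norm => // s; exact: interpolant_error.
Qed.

End Paths.

Lemma ramp_image_endpoints (phi : {linear C01 R -> C01 R}) a k N j :
  positive_map phi -> phi 1 = 1 ->
  (0 < a)%N -> (0 < k)%N ->
  (forall g, C01_ak a k g -> C01_ak a k (phi g)) -> (j < N)%N ->
  ramp_image phi N j (I01_left R) = 0 /\ ramp_image phi N j (I01_right R) = 1.
Proof.
move=> phi_pos phi1 a0 k0 phi_ak jN.
have [| |s|p0 p1] := preserves_endpoint_values phi_pos phi1 a0 k0 phi_ak
  (f := ramp_function N j).
- by rewrite /= /mkcts /abscissa /= mulr0 ramp0.
- by rewrite /= /mkcts /abscissa /= mulr1 ramp1// ler_nat.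
- have := ramp_itv (N%:R * abscissa s) j.
  by rewrite -ler0c -[_ <= 1]lecR rmorph1.
- by rewrite /ramp_image p0 p1.
Qed.

Lemma C01_finite_modulus (F : set (C01 R)) (eta : R) :
  finite_set F -> 0 < eta ->
  exists2 C : R, 0 <= C & forall f, F f ->
    forall s t, `|f s - f t| <= ((eta + C * `|abscissa s - abscissa t|)%:C)%C.
Proof.
move=> /finite_seqP[fs ->] eta0; elim: fs => [|f fs [C C0 IH]].
  by exists 0 => // f; rewrite in_nil.
have [C' C'0 f_mod] := C01_modulus f eta0.
exists (C + C') => [|g /=]; first by rewrite addr_ge0.
rewrite inE => /orP[/eqP->|gfs] s t.
  apply: le_trans (f_mod s t) _.
  by rewrite lecR lerD2l ler_wpM2r// lerDr.
apply: le_trans (IH g gfs s t) _.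
by rewrite lecR lerD2l ler_wpM2r// lerDl.
Qed.

Lemma supnorm_le (f : C01 R) (e : R) :
  (forall x, `|f x| <= (e%:C)%C) -> supnorm f <= e.
Proof.
move=> fe; apply: ge_sup => [|_ [x _ <-]].
  by exists (ComplexField.Normc.normc (f (I01_left R))), (I01_left R).
by rewrite -lecR; exact: fe.
Qed.

End QuantilePaths.

Theorem theorem1p1 (R : realType) (a k : nat) (a_gt0 : (0 < a)%N)
    (k_gt0 : (0 < k)%N) (F : set (C01 R)) (F_finite : finite_set F)
    (F_sub : F `<=` C01_ak a k) (eps : R) (eps_gt0 : 0 < eps) :
  exists N : nat, (0 < N)%N /\
    forall phi : {linear C01 R -> C01 R},
      positive_map phi -> phi 1 = 1 ->
      (forall f, C01_ak a k f -> C01_ak a k (phi f)) ->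
      exists psi : 'I_N -> C01 R -> C01 R,
        [/\ forall i, star_hom (psi i),
            forall f, C01_ak a k f -> C01_ak a k (average psi f) &
            forall f, F f -> supnorm (phi f - average psi f) < eps].
Proof.
(* Since eta = eps/6 and C/N < eps/18, the error 3 (eta + 2C/N) is below
   3 (eps/6 + eps/9) = 5 eps/6. *)
have eta0 : 0 < eps / 6 by rewrite divr_gt0.
have [C C0 F_mod] := C01_finite_modulus F_finite eta0.
pose N := (Num.truncn (C / (eps / 18))).+1.
have N0 : (0 < N)%N by [].
have CN : C / N%:R < eps / 18.
  by rewrite ltr_pdivrMr ?ltr0n// mulrC -ltr_pdivrMr ?divr_gt0// truncnS_gt.
exists N; split=> // phi phi_pos phi1 phi_ak.
exists (fun i : 'I_N => path_hom phi N i); split=> [i|f f_ak|f Ff].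
- exact: path_hom_star.
- rewrite /C01_ak /= !average_path_hom_fixed// => i.
    apply: quantile_path_right => j jN.
    by have [] := ramp_image_endpoints phi_pos phi1 a_gt0 k_gt0 phi_ak jN.
  apply: quantile_path_left => j jN.
  by have [] := ramp_image_endpoints phi_pos phi1 a_gt0 k_gt0 phi_ak jN.
- apply: (@le_lt_trans _ _ ((eps / 6 + C / N%:R *+ 2) *+ 3)); last by lra.
  apply: supnorm_le => x.
  exact: (path_average_approx phi_pos phi1 x N0 C0 (F_mod f Ff)).
Qed.
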